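(* Let $I$ be a non-empty set and let $E\subseteq\mathbb{R}^I$ be a linear subspace containing all $e_i$ ($i\in I$), endowed with a complete absolute normalised norm $\|\cdot\|_E$ such that $\operatorname{span}\{e_i:i\in I\}$ is dense in $E$. If $(X_i)_{i\in I}$ is a family of acs Banach spaces and $E$ is acs, then the absolute sum $\bigl[\bigoplus_{i\in I}X_i\bigr]_E$ is also acs.
   Context: Banach spaces are real; $S_X$ denotes the unit sphere of $X$ and $X^*$ its dual. A Banach space $X$ is called acs (alternatively convex or smooth) if for all $x,y\in S_X$ with $\|x+y\|=2$ and every $x^*\in S_{X^*}$ with $x^*(x)=1$ we have $x^*(y)=1$. For a non-empty set $I$, $e_i\in\mathbb{R}^I$ denotes the characteristic function of $\{i\}$. A norm $\|\cdot\|_E$ on a subspace $E$ of $\mathbb{R}^I$ (with all $e_i\in E$) is absolute if whenever $(a_i)_{i\in I}\in E$, $(b_i)_{i\in I}\in\mathbb{R}^I$ and $|a_i|=|b_i|$ for all $i\in I$, then $(b_i)_{i\in I}\in E$ and $\|(a_i)_{i\in I}\|_E=\|(b_i)_{i\in I}\|_E$; it is normalised if $\|e_i\|_E=1$ for every $i\in I$. For a family $(X_i)_{i\in I}$ of Banach spaces, the absolute sum with respect to $E$ is $\bigl[\bigoplus_{i\in I}X_i\bigr]_E=\{(x_i)_{i\in I}\in\prod_{i\in I}X_i:(\|x_i\|)_{i\in I}\in E\}$ with the norm $\|(x_i)_{i\in I}\|_E=\|(\|x_i\|)_{i\in I}\|_E$; it is a Banach space. *)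

(* Defs.v *)
From HB Require Import structures.
From mathcomp Require Import all_boot all_order all_algebra.
From mathcomp Require Import all_classical all_reals all_analysis.
From mathcomp Require Import ring lra.

Set Implicit Arguments.
Unset Strict Implicit.
Unset Printing Implicit Defensive.

Import Order.TTheory GRing.Theory Num.Theory.
Import numFieldNormedType.Exports.

Local Open Scope classical_set_scope.
Local Open Scope ring_scope.

(* [sup] is total, so this is meaningful only for bounded [f]. *)
Definition dual_norm (R : realType) (X : normedModType R)
    (f : {linear X -> R^o}) : R :=
  sup [set `|f x| | x in [set x : X | `|x| <= 1]].

Definition acs (R : realType) (X : completeNormedModType R) : Prop :=
  forall x y : X, `|x| = 1 -> `|y| = 1 -> `|x + y| = 2 ->
  forall f : {linear X -> R^o}, continuous f -> dual_norm f = 1 ->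
  f x = 1 -> f y = 1.

Definition lin_span (R : pzRingType) (V : lmodType R) (A : set V) : set V :=
  [set v | exists n (c : 'I_n -> R) (w : 'I_n -> V),
    (forall k, A (w k)) /\ v = \sum_(k < n) c k *: w k].

(* The values of [ns_norm] outside [ns_carrier] are irrelevant. *)
Record normed_subspace (R : realType) (I : Type) := NormedSubspace {
  ns_carrier : set (I -> R);
  ns_norm : (I -> R) -> R;
  ns_carrier0 : ns_carrier 0;
  ns_carrierP : forall (k : R) a b,
    ns_carrier a -> ns_carrier b -> ns_carrier (k *: a + b);
  ns_ler_normD : forall a b, ns_carrier a -> ns_carrier b ->
    ns_norm (a + b) <= ns_norm a + ns_norm b;
  ns_normZ : forall (k : R) a, ns_carrier a ->
    ns_norm (k *: a) = `|k| * ns_norm a;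
  ns_norm0_eq0 : forall a, ns_carrier a -> ns_norm a = 0 -> a = 0 }.

Definition ns_type (R : realType) (I : Type) (E : normed_subspace R I) : Type :=
  {a : I -> R | a \in ns_carrier E}.
Coercion ns_type : normed_subspace >-> Sortclass.

Section ns_structure.
Variables (R : realType) (I : Type) (E : normed_subspace R I).

HB.instance Definition _ := SubChoice.on (ns_type E).

Fact ns_closed : subsemimod_closed (mem (ns_carrier E)).
Proof.
split; first split.
- by apply/mem_set/ns_carrier0.
- move=> a b /set_mem Ea /set_mem Eb; apply/mem_set.
  by have := ns_carrierP 1 Ea Eb; rewrite scale1r.
- move=> k a /set_mem Ea; apply/mem_set.
  by have := ns_carrierP k Ea (ns_carrier0 E); rewrite addr0.
Qed.

HB.instance Definition _ :=
  GRing.SubChoice_isSubLmodule.Build R (I -> R) (mem (ns_carrier E))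
    (ns_type E) ns_closed.

Lemma ns_valP (a : E) : ns_carrier E (\val a).
Proof. exact/set_mem/(valP a). Qed.

Let norm (a : E) : R := ns_norm E (\val a).

Let ler_normD (a b : E) : norm (a + b) <= norm a + norm b.
Proof. by rewrite /norm raddfD; apply: ns_ler_normD; exact: ns_valP. Qed.

Let normZ (k : R) (a : E) : norm (k *: a) = `|k| * norm a.
Proof. by rewrite /norm linearZ; apply: ns_normZ; exact: ns_valP. Qed.

Let norm0_eq0 (a : E) : norm a = 0 -> a = 0.
Proof.
by move=> /ns_norm0_eq0 => /(_ (ns_valP a)) a0; apply/val_inj; rewrite a0.
Qed.

HB.instance Definition _ :=
  @Lmodule_isNormed.Build R (ns_type E) norm ler_normD normZ norm0_eq0.

Lemma ns_normE (a : E) : `|a| = ns_norm E (\val a).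
Proof. by []. Qed.

End ns_structure.

Record absolute_space (R : realType) (I : Type) := AbsoluteSpace {
  as_space :> normed_subspace R I;
  as_complete : forall F : set_system as_space,
    ProperFilter F -> cauchy F -> cvg F;
  as_unit : forall i, ns_carrier as_space \1_[set i];
  as_absolute : forall a b : I -> R, ns_carrier as_space a ->
    (forall i, `|a i| = `|b i|) ->
    ns_carrier as_space b /\ ns_norm as_space a = ns_norm as_space b;
  as_normalised : forall i, ns_norm as_space \1_[set i] = 1 }.

HB.instance Definition _ (R : realType) (I : Type) (E : absolute_space R I) :=
  Uniform_isComplete.Build (ns_type (as_space E)) (@as_complete R I E).

Lemma lim_norm_le (R : realType) (V : normedModType R) (T : Type)
    (F : set_system T) (FF : ProperFilter F) (f : T -> V) (l : V) (c : R) :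
  f @ F --> l -> (\forall t \near F, `|f t| <= c) -> `|l| <= c.
Proof. by move=> /cvg_norm fl fc; exact: (cvgr_to_le fl). Qed.

Lemma cauchy_nonexpansive (R : realType) (V W : normedModType R) (f : V -> W)
    (F : set_system V) (FF : ProperFilter F) :
  (forall x y, `|f x - f y| <= `|x - y|) -> cauchy F -> cauchy (f @ F).
Proof.
move=> f1 /cauchyP Fc; apply/cauchyP => e /Fc[x xe]; exists (f x).
suff xf : ball x e `<=` f @^-1` ball (f x) e by exact: filterS xf xe.
move=> y; rewrite /preimage/=.
by rewrite -!ball_normE/= => xy; exact: le_lt_trans (f1 x y) xy.
Qed.

Definition unit_vec (R : realType) (I : Type) (E : absolute_space R I) (i : I)
  : E := Sub \1_[set i] (mem_set (as_unit E i)).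

Section absolute_space_theory.
Variables (R : realType) (I : Type) (E : absolute_space R I).

Lemma as_coord_le (a : E) i : `|\val a i| <= `|a|.
Proof.
pose b : I -> R := fun j => if j \in [set i] then \val a j else - \val a j.
have [Eb nb] : ns_carrier E b /\ ns_norm E (\val a) = ns_norm E b.
  apply: as_absolute; first exact: ns_valP.
  by move=> j; rewrite /b; case: ifP => // _; rewrite normrN.
have ab : \val a + b = (2 * \val a i) *: \1_[set i].
  apply/funext => j.
  change (\val a j + b j = 2 * \val a i * \1_[set i] j).
  rewrite /b indicE; case: ifPn => [/set_mem -> |_]; first by rewrite mulr1 mulr_natl mulr2n.
  by rewrite subrr mulr0.
have := ns_ler_normD (ns_valP a) Eb.
rewrite ab ns_normZ; last exact: as_unit.
by rewrite as_normalised -nb -ns_normE normrM ger0_norm//; lra.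
Qed.

Lemma as_normE (a b : E) :
  (forall i, `|\val a i| = `|\val b i|) -> `|a| = `|b|.
Proof. by move=> ab; have [] := as_absolute (ns_valP a) ab. Qed.

(* Membership comes from completeness: [a] is expanded as a series
   \sum_n 2^-(n+1) *: s_n with |s_n i| = |b i| for all i. *)
Section solid.
Variables (a : I -> R) (b : E).
Hypothesis ab : forall i, `|a i| <= `|\val b i|.

Let sgn (A : I -> R) : I -> R :=
  fun i => if A i <= a i then `|\val b i| else - `|\val b i|.

Let Esgn A : sgn A \in ns_carrier E.
Proof.
apply/mem_set; have [] // := @as_absolute _ _ E (\val b) (sgn A) (ns_valP b).
by move=> i; rewrite /sgn; case: ifP; rewrite ?normrN normr_id.
Qed.

Let s A : E := Sub (sgn A) (Esgn A).

Let norm_s A : `|s A| = `|b|.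
Proof.
apply: as_normE => i; rewrite SubK /sgn.
by case: ifP; rewrite ?normrN normr_id.
Qed.

Let Fixpoint A n : E :=
  if n is m.+1 then A m + 2^-1 ^+ m.+1 *: s (\val (A m)) else 0.

Let u n : E := 2^-1 ^+ n.+1 *: s (\val (A n)).

Let series_u : series u = A.
Proof.
apply/funext; elim=> [|n IH]; first by rewrite /series/= big_geq.
by rewrite /series/= big_nat_recr//= -[X in X + _]/(series u n) IH.
Qed.

Let A_close n i : `|a i - \val (A n) i| <= 2^-1 ^+ n * `|\val b i|.
Proof.
elim: n => [|n IH]; first by rewrite (_ : \val (A 0) i = 0)// subr0 expr0 mul1r.
rewrite [A n.+1]/=.
change (`|a i - (\val (A n) i + 2^-1 ^+ n.+1 * sgn (\val (A n)) i)|
  <= 2^-1 ^+ n.+1 * `|\val b i|).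
rewrite /sgn; have b0 := normr_ge0 (\val b i).
set t := 2^-1 ^+ n in IH *; have t0 : 0 <= t by rewrite exprn_ge0.
rewrite exprS -/t; move: IH; rewrite !ler_norml => /andP[h1 h2].
set c := `|_| in b0 h1 h2 *.
rewrite -[2^-1 * t * c]mulrA.
have := mulr_ge0 t0 b0; set d := t * c in h1 h2 * => d0.
case: ifPn => [h|]; last rewrite -ltNge => h; first last.
  by rewrite mulrN -mulrA -/d; apply/andP; split; lra.
by rewrite -mulrA -/d; apply/andP; split; lra.
Qed.

Let norm_u : [normed series u] = series (geometric (2^-1 * `|b|) 2^-1).
Proof.
apply/funext => n; apply: eq_bigr => k _.
by rewrite -[LHS]/(`|u k|) /u normrZ norm_s ger0_norm ?exprn_ge0// exprS mulrAC.
Qed.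

Let norm_A n : `|A n| <= `|b|.
Proof.
rewrite -series_u; apply: (le_trans (ler_norm_sum _ _ _)).
rewrite -[leLHS]/([normed series u] n) norm_u geometric_seriesE; last first.
  by rewrite lt_eqF//; lra.
rewrite /= (_ : 1 - 2^-1 = 2^-1 :> R); last lra.
rewrite invrK; have : 0 <= 2^-1 ^+ n :> R by rewrite exprn_ge0.
have := normr_ge0 b; nra.
Qed.

Lemma as_solid : ns_carrier E a /\ ns_norm E a <= `|b|.
Proof.
have z1 : `|2^-1 : R| < 1 by rewrite ger0_norm//; lra.
have /cvg_ex[l Al] : cvgn A.
  rewrite -series_u; apply: normed_cvg; rewrite norm_u.
  exact: is_cvg_geometric_series.
suff -> : a = \val l.
  split; first exact: ns_valP.
  rewrite -ns_normE; apply: lim_norm_le Al _.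
  by apply: nearW => n; exact: norm_A.
apply/funext => i; apply: (@cvg_unique R _ ((fun n => \val (A n) i) @ \oo)) => //.
- apply/cvgrPdist_le => e e0.
  have /cvgrPdist_le/(_ _ e0) := cvg_geometric `|\val b i| z1.
  apply: filterS => n; rewrite sub0r normrN ger0_norm; last first.
    by rewrite mulr_ge0// exprn_ge0.
  by apply: le_trans; rewrite [leRHS]mulrC; exact: A_close.
- apply/cvgrPdist_le => e e0.
  move/cvgrPdist_le: Al => /(_ _ e0); apply: filterS => n.
  by apply: le_trans; have := as_coord_le (l - A n) i; rewrite raddfB.
Qed.

End solid.
End absolute_space_theory.

Definition prod_space (R : realType) (I : Type)
  (X : I -> completeNormedModType R) : Type := forall i, X i.

Section prod_space_lmod.
Variables (R : realType) (I : Type) (X : I -> completeNormedModType R).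
Local Notation P := (prod_space X).
Implicit Types x y z : P.

HB.instance Definition _ := gen_eqMixin P.
HB.instance Definition _ := gen_choiceMixin P.

Let add x y : P := fun i => x i + y i.
Let opp x : P := fun i => - x i.
Let zero : P := fun=> 0.
Let scale (k : R) x : P := fun i => k *: x i.

Let addA : associative add.
Proof. by move=> x y z; apply: functional_extensionality_dep => i; exact: addrA. Qed.
Let addC : commutative add.
Proof. by move=> x y; apply: functional_extensionality_dep => i; exact: addrC. Qed.
Let add0 : left_id zero add.
Proof. by move=> x; apply: functional_extensionality_dep => i; exact: add0r. Qed.
Let addN : left_inverse zero opp add.
Proof. by move=> x; apply: functional_extensionality_dep => i; exact: addNr. Qed.

HB.instance Definition _ := GRing.isZmodule.Build P addA addC add0 addN.

Let scaleA k l x : scale k (scale l x) = scale (k * l) x.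
Proof. by apply: functional_extensionality_dep => i; exact: scalerA. Qed.
Let scale1 : left_id 1 scale.
Proof. by move=> x; apply: functional_extensionality_dep => i; exact: scale1r. Qed.
Let scaleDr : right_distributive scale +%R.
Proof.
by move=> k x y; apply: functional_extensionality_dep => i; exact: scalerDr.
Qed.
Let scaleDl x : {morph scale^~ x : k l / k + l}.
Proof.
by move=> k l; apply: functional_extensionality_dep => i; exact: scalerDl.
Qed.

HB.instance Definition _ :=
  GRing.Zmodule_isLmodule.Build R P scaleA scale1 scaleDr scaleDl.

End prod_space_lmod.

Section absolute_sum.
Variables (R : realType) (I : Type) (E : absolute_space R I).
Variable X : I -> completeNormedModType R.

Definition norm_family (x : prod_space X) : I -> R := fun i => `|x i|.

Definition absolute_sum_set : set (prod_space X) :=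
  [set x | ns_carrier E (norm_family x)].

Definition absolute_sum : Type :=
  {x : prod_space X | x \in absolute_sum_set}.

HB.instance Definition _ := SubChoice.on absolute_sum.

Let ge0_solid (a b : I -> R) : ns_carrier E b ->
  (forall i, `|a i| <= `|b i|) -> ns_carrier E a /\ ns_norm E a <= ns_norm E b.
Proof. 
move=> Eb ab; pose b' : E := Sub b (mem_set Eb).
by have := @as_solid _ _ E a b'; rewrite ns_normE SubK; exact.
Qed.

Let carrierD a b : ns_carrier E a -> ns_carrier E b -> ns_carrier E (a + b).
Proof. by move=> Ea Eb; have := ns_carrierP 1 Ea Eb; rewrite scale1r. Qed.

Let carrierZ k a : ns_carrier E a -> ns_carrier E (k *: a).
Proof.
by move=> Ea; have := ns_carrierP k Ea (ns_carrier0 E); rewrite addr0.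
Qed.

Let norm_familyD x y i :
  `|norm_family (x + y) i| <= `|(norm_family x + norm_family y) i|.
Proof.
rewrite /norm_family normr_id.
apply: (le_trans (ler_normD (x i) (y i))); exact: ler_norm.
Qed.

Let norm_familyZ k x : norm_family (k *: x) = `|k| *: norm_family x.
Proof. by apply/funext => i; exact: normrZ. Qed.

Fact absolute_sum_closed : subsemimod_closed (mem absolute_sum_set).
Proof.
split; first split.
- apply/mem_set; rewrite /absolute_sum_set/= (_ : norm_family 0 = 0).
    exact: ns_carrier0.
  by apply/funext => i; exact: normr0.
- move=> x y /set_mem Ex /set_mem Ey; apply/mem_set.
  by have [] := ge0_solid (carrierD Ex Ey) (norm_familyD x y).
- move=> k x /set_mem Ex; apply/mem_set.
  by rewrite /absolute_sum_set/= norm_familyZ; exact: carrierZ.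
Qed.

HB.instance Definition _ :=
  GRing.SubChoice_isSubLmodule.Build R (prod_space X) (mem absolute_sum_set)
    absolute_sum absolute_sum_closed.

Let sumP (x : absolute_sum) : ns_carrier E (norm_family (\val x)).
Proof. exact/set_mem/(valP x). Qed.

Let norm (x : absolute_sum) : R := ns_norm E (norm_family (\val x)).

Let norm_ler_normD (x y : absolute_sum) : norm (x + y) <= norm x + norm y.
Proof.
apply: le_trans (ns_ler_normD (sumP x) (sumP y)).
rewrite /norm raddfD.
by have [] := ge0_solid (carrierD (sumP x) (sumP y))
  (norm_familyD (\val x) (\val y)).
Qed.

Let norm_normZ (k : R) (x : absolute_sum) : norm (k *: x) = `|k| * norm x.
Proof.
by rewrite /norm linearZ norm_familyZ ns_normZ ?normr_id//; exact: sumP.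
Qed.

Let norm_norm0_eq0 (x : absolute_sum) : norm x = 0 -> x = 0.
Proof.
move=> /(ns_norm0_eq0 (sumP x)) x0; apply/val_inj.
apply: functional_extensionality_dep => i; apply/normr0_eq0.
by have := congr1 (@^~ i) x0.
Qed.

HB.instance Definition _ := @Lmodule_isNormed.Build R absolute_sum norm
  norm_ler_normD norm_normZ norm_norm0_eq0.

Lemma absolute_sum_normE (x : absolute_sum) :
  `|x| = ns_norm E (norm_family (\val x)).
Proof. by []. Qed.

Let nu (x : absolute_sum) : E :=
  Sub (norm_family (\val x)) (mem_set (sumP x)).

Let nuE x : `|nu x| = `|x|. Proof. by []. Qed.

Let nu_nonexpansive (y x z : absolute_sum) :
  `|nu (x - y) - nu (z - y)| <= `|x - z|.
Proof.
suff H i : `|\val (nu (x - y) - nu (z - y)) i| <= `|\val (nu (x - z)) i|.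
  by have [] := as_solid H.
rewrite [leRHS]normr_id.
have -> : x - z = (x - y) - (z - y) by rewrite opprB addrA subrK.
by apply: le_trans (ler_dist_dist _ _) _; rewrite raddfB.
Qed.

Let coord_nonexpansive i (x z : absolute_sum) :
  `|\val x i - \val z i| <= `|x - z|.
Proof.
have := as_coord_le (nu (x - z)) i; rewrite nuE; apply: le_trans.
by rewrite [leRHS]normr_id raddfB.
Qed.

Let sum_complete (F : set_system absolute_sum) :
  ProperFilter F -> cauchy F -> cvg F.
Proof.
move=> FF Fc.
pose xl : prod_space X := fun i => lim (\val x i @[x --> F]).
have xlP i : \val x i @[x --> F] --> xl i.
  apply: cauchy_cvg; apply: cauchy_nonexpansive => //.
  exact: coord_nonexpansive.
have claim y : exists c : E, nu (x - y) @[x --> F] --> c /\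
    \val c = norm_family (xl - \val y).
  have /cvg_ex[c cP] : cvg (nu (x - y) @[x --> F]).
    apply: cauchy_cvg.
    apply: (@cauchy_nonexpansive _ _ _ (fun x => nu (x - y))) => //.
  exists c; split => //; apply/funext => i.
  apply: (@cvg_unique R _ (`|\val x i - \val y i| @[x --> F])) => //.
    apply/cvgrPdist_le => e e0.
    move/cvgrPdist_le: cP => /(_ _ e0); apply: filterS => x.
    by apply: le_trans; have := as_coord_le (c - nu (x - y)) i; rewrite !raddfB.
  by apply: cvg_norm; apply: cvgB; [exact: xlP|exact: cvg_cst].
have Exl : xl \in absolute_sum_set.
  have [c [_ cE]] := claim 0; apply/mem_set; rewrite /absolute_sum_set/=.
  by have := ns_valP c; rewrite cE [X in norm_family X](subr0 xl).
pose l : absolute_sum := Sub xl Exl.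
apply/cvg_ex; exists l.
suff : id @ F --> l by [].
apply/cvgrPdist_le => e e0.
have /cauchyP/(_ (e / 2))[|x0 Fx0] := Fc; first by rewrite divr_gt0.
apply: filterS (Fx0) => y; rewrite -ball_normE/= => x0y.
have [c [cP cE]] := claim y.
have -> : `|l - y| = `|c| by rewrite absolute_sum_normE ns_normE cE raddfB.
apply: lim_norm_le cP _; apply: filterS (Fx0) => z.
rewrite -ball_normE/= nuE => x0z.
rewrite (splitr e) (le_trans (ler_distD x0 _ _))// lerD// ltW//.
by rewrite distrC.
Qed.

HB.instance Definition _ := Uniform_isComplete.Build absolute_sum sum_complete.

End absolute_sum.

(* Main.v *)
Require Import Defs.
From HB Require Import structures.
From mathcomp Require Import all_boot all_order all_algebra.
From mathcomp Require Import all_classical all_reals all_analysis.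
From mathcomp Require Import ring lra.

Set Implicit Arguments.
Unset Strict Implicit.
Unset Printing Implicit Defensive.

Import Order.TTheory GRing.Theory Num.Theory.
Import numFieldNormedType.Exports.

Local Open Scope classical_set_scope.
Local Open Scope ring_scope.

(** Let x and y be unit vectors of the sum with
    |x + y| = 2, and let f be a functional of norm one with f x = 1.
    Write a and b for the families of norms of x and y, and u_i for x_i
    divided by its norm, or for y_i divided by its norm when x_i = 0.  The
    multiplier T : h |-> (h_i u_i)_i is a linear contraction from E into the
    sum with T a = x, so g = f \o T is a functional on E that norms a.  This
    replaces the usual functional h |-> \sum_i |f_i| h_i, where f_i is the
    restriction of f to X_i, and avoids all infinite sums.

    As 2 = |x + y| <= |a + b| <= 2, the space E being acs gives g b = 1, that
    is f (T b) = 1, and it remains to see that f vanishes on z = T b - y.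
    The span of the unit vectors being dense, it is enough that each f_i
    vanishes on z_i ([functional_eq0], again by means of a multiplier).

    If x_i = 0, then z_i = 0 by the choice of u_i.  Otherwise f_i attains its
    norm k at u_i, since x_i may be exchanged inside x for any vector of X_i
    that is not longer ([norming_coord]).  Moreover k = g e_i, and k vanishes
    unless |x_i + y_i| = |x_i| + |y_i|: the family of the |x_i + y_i| has the
    same norm as a + b and lies below it, and in an acs space E a functional
    norming a + b cannot see such a gap ([norming_gap]).  So either f_i = 0,
    or the space X_i being acs yields f_i y_i = k |y_i| ([acs_norming]), which
    is f_i (|y_i| u_i). *)

(** * Norming functionals in normed spaces *)

Section functionals.
Variables (R : realType) (V : normedModType R).
Implicit Types (f : {linear V -> R^o}) (k s t : R) (v w x y : V).

Lemma norm_le_of_le f k : (forall v, f v <= k * `|v|) ->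
  forall v, `|f v| <= k * `|v|.
Proof.
move=> fk v; rewrite ler_norml fk andbT lerNl.
by have := fk (- v); rewrite linearN normrN.
Qed.

Lemma continuous_of_norm_le f k : (forall v, `|f v| <= k * `|v|) ->
  continuous f.
Proof.
move=> fk; apply: bounded_linear_continuous.
apply/linear_boundedP; exists k; split; first exact: num_real.
by move=> r kr v; rewrite (le_trans (fk v))// ler_wpM2r// ltW.
Qed.

Lemma le_dual_norm f : continuous f -> forall v, `|f v| <= dual_norm f * `|v|.
Proof.
move=> fc v; have [->|v0] := eqVneq v 0.
  by rewrite linear0 !normr0 mulr0.
have nv : 0 < `|v| by rewrite normr_gt0.
have /linear_boundedP[r [_ fr]] : bounded_near f (nbhs 0).
  by apply: continuous_linear_bounded; exact: fc.
have ub : has_ubound [set `|f x| | x in [set x : V | `|x| <= 1]].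
  exists (`|r| + 1) => _ [x x1 <-].
  rewrite (le_trans (fr (`|r| + 1) _ x))//.
    by rewrite (le_lt_trans (ler_norm r))// ltrDl.
  by rewrite ler_piMr// addr_ge0.
have : `|f (`|v|^-1 *: v)| <= dual_norm f.
  apply: ub_le_sup => //; exists (`|v|^-1 *: v) => //=.
  by rewrite normrZ ger0_norm ?invr_ge0// mulVf// gt_eqF.
rewrite linearZ -[X in `|X|]/(`|v|^-1 * f v) normrM ger0_norm ?invr_ge0//.
by rewrite mulrC ler_pdivrMr.
Qed.

Lemma dual_norm_eq1 f x : (forall v, `|f v| <= `|v|) -> `|x| = 1 -> f x = 1 ->
  dual_norm f = 1.
Proof.
move=> f1 x1 fx.
have ub : ubound [set `|f x| | x in [set x : V | `|x| <= 1]] 1.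
  by move=> _ [v v1 <-]; exact: le_trans (f1 v) v1.
have f_x : [set `|f x| | x in [set x : V | `|x| <= 1]] 1.
  by exists x; [rewrite /= x1|rewrite fx normr1].
apply/eqP; rewrite eq_le; apply/andP; split.
  by apply: ge_sup => //; exists 1.
by apply: ub_le_sup => //; exists 1.
Qed.

(** Equality in the triangle inequality passes to nonnegative combinations: if
    s <= t, then t (x + y) exceeds s x + t y by (t - s) x only.  This allows
    the vectors in the definition of acs to be rescaled. *)
Lemma normD_eqZ x y s t : 0 <= s -> 0 <= t -> `|x + y| = `|x| + `|y| ->
  `|s *: x + t *: y| = s * `|x| + t * `|y|.
Proof.
wlog st : x y s t / s <= t => [th s0 t0 xy|s0 t0 xy].
  have [/th|/ltW/th] := leP s t; first exact.
  by rewrite addrC [RHS]addrC; apply => //; rewrite addrC xy addrC.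
apply/eqP; rewrite eq_le; apply/andP; split.
  by rewrite (le_trans (ler_normD _ _))// !normrZ !ger0_norm.
have : `|t *: (x + y)| <= `|s *: x + t *: y| + `|(t - s) *: x|.
  rewrite (le_trans _ (ler_normD _ _))// scalerBl addrAC addrCA subrr addr0.
  by rewrite scalerDr.
rewrite !normrZ xy (ger0_norm t0) ger0_norm ?subr_ge0//; lra.
Qed.

Definition direction w : V := `|w|^-1 *: w.

Lemma direction_le1 w : `|direction w| <= 1.
Proof.
rewrite normrZ ger0_norm ?invr_ge0//; have [->|w0] := eqVneq w 0.
  by rewrite normr0 mulr0.
by rewrite mulVf// normr_eq0.
Qed.

Lemma norm_direction w : `|w| *: direction w = w.
Proof.
have [->|w0] := eqVneq w 0; first by rewrite normr0 scale0r.
by rewrite scalerA mulfV ?scale1r// normr_eq0.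
Qed.

Lemma dense_ker_eq0 f (D : set V) : continuous f -> dense D ->
  (forall v, D v -> f v = 0) -> forall v, f v = 0.
Proof.
move=> fc Dd fD v; apply/eqP/negP => /negP fv.
have [||w [/= fw /fD]] := Dd (f @^-1` [set r | r != 0]).
- by exists v.
- by apply: open_comp => [x _|]; [exact: fc|exact: open_neq].
- by move/eqP; rewrite (negbTE fw).
Qed.

End functionals.

(** Homogeneous form of the acs property, obtained by rescaling x, y and f.  The
    constant k stands for the norm of f: the hypothesis on f bounds the norm
    by k, and the value at x shows that it is not smaller. *)
Lemma acs_norming (R : realType) (V : completeNormedModType R)
    (f : {linear V -> R^o}) (k : R) (x y : V) :
  acs V -> (forall v, f v <= k * `|v|) -> x != 0 -> f x = k * `|x| ->
  `|x + y| = `|x| + `|y| -> f y = k * `|y|.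
Proof.
move=> acsV /norm_le_of_le fk x0 fx xy.
have [->|y0] := eqVneq y 0; first by rewrite linear0 normr0 mulr0.
have nx : 0 < `|x| by rewrite normr_gt0.
have ny : 0 < `|y| by rewrite normr_gt0.
have k0 : 0 <= k by have := le_trans (normr_ge0 _) (fk x); rewrite pmulr_lge0.
have [k00|kN0] := eqVneq k 0.
  by apply/eqP; rewrite k00 mul0r -normr_le0 -(mul0r `|y|) -k00 fk.
have kp : 0 < k by rewrite lt_neqAle eq_sym kN0.
pose g : {linear V -> R^o} := k^-1 \*: f.
have gE v : g v = k^-1 * f v by [].
have g1 v : `|g v| <= `|v|.
  by rewrite gE normrM ger0_norm ?invr_ge0// mulrC ler_pdivrMr// mulrC fk.
have unit (v : V) : 0 < `|v| -> `|(`|v|^-1 *: v)| = 1.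
  by move=> nv; rewrite normrZ ger0_norm ?invr_ge0// mulVf// gt_eqF.
have gx : g (`|x|^-1 *: x) = 1.
  rewrite linearZ -[LHS]/(`|x|^-1 * g x) gE fx.
  by field; rewrite kN0 gt_eqF.
have gc : continuous g.
  by apply: (@continuous_of_norm_le _ _ _ 1) => v; rewrite mul1r.
have := acsV _ _ (unit _ nx) (unit _ ny) _ g gc
  (dual_norm_eq1 g1 (unit _ nx) gx) gx.
rewrite normD_eqZ ?invr_ge0// !mulVf ?gt_eqF// => /(_ erefl).
rewrite linearZ -[LHS]/(`|y|^-1 * g y) gE => /(congr1 ( *%R (k * `|y|))).
by rewrite mulr1 => <-; field; rewrite kN0 gt_eqF.
Qed.

(** * Coordinates and multipliers in absolute sums *)

Section sums.
Variables (R : realType) (I : Type) (E : absolute_space R I).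

Lemma as_norm_le (a b : E) : (forall i, `|\val a i| <= `|\val b i|) ->
  `|a| <= `|b|.
Proof. by case/as_solid. Qed.

Variable X : I -> completeNormedModType R.
Local Notation S := (absolute_sum E X).

Lemma absolute_sum_ext (x y : S) : (forall i, \val x i = \val y i) -> x = y.
Proof. by move=> xy; apply/val_inj/functional_extensionality_dep. Qed.

Definition norm_seq (x : S) : E :=
  Sub (norm_family (\val x)) (mem_set (set_mem (valP x))).

Lemma norm_seqE x i : \val (norm_seq x) i = `|\val x i|.
Proof. by []. Qed.

Lemma norm_norm_seq x : `|norm_seq x| = `|x|. Proof. by []. Qed.

Lemma absolute_sum_norm_le (x y : S) :
  (forall i, `|\val x i| <= `|\val y i|) -> `|x| <= `|y|.
Proof.
move=> xy; rewrite -!norm_norm_seq; apply: as_norm_le => i.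
by rewrite !norm_seqE !normr_id.
Qed.

(** Such multipliers transport functionals from the sum to E; the factors v i
    being in the unit balls, h bounds (h_i v_i)_i coordinatewise, which gives
    both membership in the sum and contractivity. *)
Lemma multiplier (v : prod_space X) : (forall i, `|v i| <= 1) ->
  exists T : {linear E -> S}, (forall h i, \val (T h) i = \val h i *: v i) /\
    forall h, `|T h| <= `|h|.
Proof.
move=> v1.
have vh (h : E) i : `|norm_family (fun i => \val h i *: v i) i| <= `|\val h i|.
  by rewrite [leLHS]normr_id normrZ ler_piMr // v1.
pose T (h : E) : S := Sub (fun i => \val h i *: v i : X i)
  (mem_set (as_solid (vh h)).1).
have Tlin : linear T.
  move=> k g h; apply: absolute_sum_ext => i.
  change ((k * \val g i + \val h i) *: v i =
    k *: (\val g i *: v i) + \val h i *: v i).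
  by rewrite scalerDl scalerA.
pose TL := GRing.isLinear.Build _ _ _ _ T Tlin.
pose L : {linear E -> S} := HB.pack T TL.
by exists L; split=> // h; have [] := as_solid (vh h).
Qed.

(** The family with entry w at i and 0 elsewhere; the transport along i = j is
    forced by the dependency of X on the index. *)
Definition single i (w : X i) : prod_space X := fun j =>
  if pselect (i = j) is left e then eq_rect i X w j e else 0.

Lemma single_same i (w : X i) : single w i = w.
Proof.
rewrite /single; case: pselect => // e.
by rewrite (Prop_irrelevance e erefl).
Qed.

Lemma single_other i j (w : X i) : i <> j -> single w j = 0.
Proof. by rewrite /single; case: pselect. Qed.

Lemma single_in_sum i (w : X i) : single w \in absolute_sum_set E (X := X).
Proof.
apply/mem_set; rewrite /absolute_sum_set/=.
rewrite (_ : norm_family _ = `|w| *: \1_[set i]).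
  have := ns_carrierP `|w| (as_unit E i) (ns_carrier0 E).
  by rewrite addr0.
apply/funext => j; change (`|single w j| = `|w| * \1_[set i] j).
rewrite indicE; have [<-|ij] := pselect (i = j).
  by rewrite single_same mem_set// mulr1.
by rewrite single_other// normr0 memNset ?mulr0// => /esym.
Qed.

Definition coord_emb i (w : X i) : S := Sub (single w) (single_in_sum w).

Fact coord_emb_linear i : linear (@coord_emb i).
Proof.
move=> k g h; apply: absolute_sum_ext => j.
change (single (k *: g + h) j = k *: single g j + single h j).
have [<-|ij] := pselect (i = j); first by rewrite !single_same.
by rewrite !single_other// scaler0 addr0.
Qed.

HB.instance Definition _ i :=
  GRing.isLinear.Build _ _ _ _ (@coord_emb i) (@coord_emb_linear i).

Lemma multiplier_unit (T : {linear E -> S}) (v : prod_space X) i :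
  (forall h j, \val (T h) j = \val h j *: v j) ->
  T (unit_vec E i) = coord_emb (v i).
Proof.
move=> TE; apply: absolute_sum_ext => j; rewrite TE.
change (\1_[set i] j *: v j = single (v i) j); rewrite indicE.
have [<-|ij] := pselect (i = j).
  by rewrite single_same mem_set// scale1r.
by rewrite single_other// memNset ?scale0r// => /esym.
Qed.

(** * Vanishing, norming and gaps *)

(** Writing z = T |z|, where |z| is the family of norms of z and T the
    multiplier by the directions of the z_i, the functional f \o T vanishes on
    the unit vectors of E, hence by density at |z|. *)
Lemma functional_eq0 (f : {linear S -> R^o}) (z : S) :
  dense (lin_span (range (unit_vec E))) -> (forall w, `|f w| <= `|w|) ->
  (forall i, f (coord_emb (i := i) (\val z i)) = 0) -> f z = 0.
Proof.
move=> spanD f1 fz.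
have [T [TE Tle]] := multiplier (fun i => direction_le1 (\val z i)).
have -> : z = T (norm_seq z).
  by apply: absolute_sum_ext => i; rewrite TE norm_seqE norm_direction.
pose g : {linear E -> R^o} := f \o T.
apply: (dense_ker_eq0 (f := g) _ spanD) => [|_ [n [c [w [wE ->]]]]].
  apply: (@continuous_of_norm_le _ _ _ 1) => h.
  by rewrite mul1r (le_trans (f1 _)).
rewrite linear_sum big1// => k _; have [i _ <-] := wE k.
rewrite linearZ -[LHS]/(c k * f (T (unit_vec E i))) (multiplier_unit _ TE).
by rewrite /direction !linearZ/= fz scaler0 mulr0.
Qed.

(** Exchanging x_i for a vector w of X_i with |w| <= |x_i| does not increase
    the norm of x, so f cannot increase either: on the ball of radius |x_i| the
    restriction of f to X_i is largest at x_i. *)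
Lemma norming_coord (f : {linear S -> R^o}) (x : S) i :
  (forall v, `|f v| <= `|v|) -> f x = `|x| -> \val x i != 0 ->
  forall w : X i, f (coord_emb w) <=
    f (coord_emb (i := i) (\val x i)) / `|\val x i| * `|w|.
Proof.
move=> f1 fx xi0 w.
have [->|w0] := eqVneq w 0; first by rewrite !linear0 normr0 mulr0.
have nx : 0 < `|\val x i| by rewrite normr_gt0.
have nw : 0 < `|w| by rewrite normr_gt0.
pose w' := (`|\val x i| / `|w|) *: w.
have fw' : f (coord_emb w') <= f (coord_emb (i := i) (\val x i)).
  have : f (x + coord_emb (w' - \val x i)) <= `|x|.
    apply: le_trans (ler_norm _) (le_trans (f1 _) _).
    apply: absolute_sum_norm_le => j.
    change (`|\val x j + single (w' - \val x i) j| <= `|\val x j|).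
    have [<-|ij] := pselect (i = j); last by rewrite single_other// addr0.
    rewrite single_same addrC subrK normrZ ger0_norm ?divr_ge0//.
    by rewrite mulfVK// gt_eqF.
  by rewrite linearD fx gerDl linearB/= linearB/= subr_le0.
move: fw'; rewrite /w' linearZ linearZ.
rewrite -[leLHS]/(`|\val x i| / `|w| * f (coord_emb w)) => fw'.
by move: fw'; rewrite mulrAC ler_pdivrMr// mulrAC ler_pdivlMr// mulrC.
Qed.

(** Replace by q_i the entry at i only of p.  The resulting c lies between q and
    p, so |c| = |p|, and 2 q <= p + c gives |p + c| = |p| + |c|.  As E is acs,
    g norms c as well, and p - c is a multiple of the unit vector at i.  Moving
    a single entry at a time is what makes this work without knowing the signs
    of g on the other unit vectors. *)
Lemma norming_gap (g : {linear E -> R^o}) (p q : E) i :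
  acs E -> (forall h, g h <= `|h|) -> g p = `|p| ->
  (forall j, 0 <= \val q j <= \val p j) -> `|q| = `|p| ->
  (\val p i - \val q i) * g (unit_vec E i) = 0.
Proof.
move=> acsE g1 gp qp nqp.
have [p0|p0] := eqVneq p 0.
  have := qp i; rewrite p0 -[\val 0 i]/0 => qi0.
  by rewrite (_ : \val q i = 0) ?subrr ?mul0r//; lra.
set d := _ - _; pose c := p - d *: unit_vec E i.
have cE j : \val c j = if j \in [set i] then \val q j else \val p j.
  change (\val p j - d * \1_[set i] j =
    if j \in [set i] then \val q j else \val p j).
  rewrite indicE; case: ifPn => [/set_mem->|_].
    by rewrite mulr1 /d opprB addrC subrK.
  by rewrite mulr0 subr0.
have nc : `|c| = `|p|.
  apply/eqP; rewrite eq_le -{2}nqp; apply/andP; split; apply: as_norm_le => j.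
    by have := qp j; rewrite cE; case: ifP => _ ?; rewrite !ger0_norm; lra.
  by have := qp j; rewrite cE; case: ifP => _ ?; rewrite !ger0_norm; lra.
have npc : `|p + c| = `|p| + `|c|.
  apply/eqP; rewrite eq_le ler_normD/= nc -nqp.
  have -> : `|q| + `|q| = `|2 *: q| by rewrite normrZ ger0_norm//; lra.
  apply: as_norm_le => j; change (`|2 * \val q j| <= `|\val p j + \val c j|).
  by have := qp j; rewrite cE; case: ifP => _ ?; rewrite !ger0_norm; lra.
have := @acs_norming _ _ g 1 p c acsE.
move=> /(_ _ p0 _ npc); rewrite !mul1r => gc.
have : g c = `|c| by apply: gc => // h; rewrite mul1r.
rewrite nc -gp linearB linearZ/= => /eqP.
by rewrite -subr_eq0 addrAC subrr sub0r oppr_eq0 => /eqP.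
Qed.

End sums.

Theorem proposition3p3 (R : realType) (I : Type) (E : absolute_space R I)
    (X : I -> completeNormedModType R)
    (I_nonempty : [set: I] !=set0)
    (span_dense : dense (lin_span (range (unit_vec E))))
    (acs_X : forall i, acs (X i))
    (acs_E : acs E) :
  acs (absolute_sum E X).
Proof.
move=> x y nx ny nxy f fc nf fx.
have f1 v : `|f v| <= `|v| by have := le_dual_norm fc v; rewrite nf mul1r.
(* Where x_i = 0, directing u_i along y_i makes T b and y agree at i. *)
pose u : prod_space X := fun i =>
  direction (if \val x i == 0 then \val y i else \val x i).
have [T [TE Tle]] : exists T : {linear E -> absolute_sum E X},
    (forall h i, \val (T h) i = \val h i *: u i) /\ forall h, `|T h| <= `|h|.
  by apply: multiplier => i; exact: direction_le1.
pose a := norm_seq x; pose b := norm_seq y.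
have Ta : T a = x.
  apply: absolute_sum_ext => i; rewrite TE norm_seqE /u.
  by case: eqP => [->|_]; rewrite ?normr0 ?scale0r// norm_direction.
pose g : {linear E -> R^o} := f \o T.
have g1 h : g h <= `|h|.
  exact: le_trans (ler_norm _) (le_trans (f1 _) (Tle _)).
have ga : g a = `|a| by rewrite /g/= Ta fx norm_norm_seq nx.
have cab j : 0 <= \val (norm_seq (x + y)) j <= \val (a + b) j.
  by rewrite norm_seqE normr_ge0; exact: ler_normD.
have nab : `|a + b| = `|a| + `|b|.
  apply/eqP; rewrite eq_le ler_normD/= !norm_norm_seq nx ny.
  rewrite [leLHS](_ : _ = 2)// -nxy -norm_norm_seq; apply: as_norm_le => j.
  by have := cab j; move=> ?; rewrite !ger0_norm; lra.
have gb : g b = `|b|.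
  rewrite -[RHS]mul1r; apply: (acs_norming (x := a)) => //.
  - by move=> h; rewrite mul1r.
  - by rewrite -normr_eq0 norm_norm_seq nx oner_eq0.
  - by rewrite mul1r.
suff : f (T b - y) = 0.
  rewrite linearB -[f (T b)]/(g b) gb norm_norm_seq ny => /eqP.
  by rewrite subr_eq0 => /eqP <-.
apply: functional_eq0 => // i.
rewrite (_ : \val (T b - y) i = `|\val y i| *: u i - \val y i); last first.
  by rewrite raddfB -[LHS]/(\val (T b) i - \val y i) TE.
have [xi0|xi0] := eqVneq (\val x i) 0.
  by rewrite /u xi0 eqxx norm_direction subrr !linear0.
have uE : u i = direction (\val x i) by rewrite /u (negbTE xi0).
pose fi : {linear X i -> R^o} := f \o @coord_emb _ _ E X i.
pose k : R := fi (\val x i) / `|\val x i|.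
have fik w : fi w <= k * `|w|.
  by apply: norming_coord => //; rewrite fx nx.
have fiu : fi (u i) = k.
  by rewrite uE linearZ -[LHS]/(`|\val x i|^-1 * fi (\val x i)) mulrC.
have gap : (`|\val x i| + `|\val y i| - `|\val x i + \val y i|) * k = 0.
  have := @norming_gap _ _ _ g (a + b) (norm_seq (x + y)) i acs_E g1 _ cab.
  rewrite (_ : g (unit_vec E i) = k); last first.
    by rewrite /g/= (multiplier_unit _ TE) -fiu.
  apply; last by rewrite nab !norm_norm_seq nx ny nxy.
  by rewrite linearD ga gb nab.
(* This suffices because fi (|y_i| u_i) = k |y_i|. *)
suff : fi (\val y i) = k * `|\val y i|.
  rewrite -[f _]/(fi _) linearB linearZ => ->.
  by rewrite fiu [X in X - _]mulrC subrr.
move/eqP: gap; rewrite mulf_eq0 => /orP[|/eqP k0].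
  rewrite subr_eq0 => /eqP nxyi.
  apply: (acs_norming (y := \val y i) (acs_X i) fik xi0) => //.
  by rewrite /k mulfVK// normr_eq0.
have := norm_le_of_le fik (\val y i).
by rewrite k0 !mul0r normr_le0 => /eqP.
Qed.
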